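(* (a) For every odd prime $p$ there exists a spectral set of size $2p$ in $\mathbb{Z}_p^5$ which does not tile. (b) For every prime $p\equiv 3 \pmod 4$ there exists a spectral set of size $2p$ in $\mathbb{Z}_p^4$ which does not tile. Thus, for nonempty sets $E\subseteq\mathbb{Z}_p^d$, the implication ''$E$ spectral $\Rightarrow$ $E$ tiles'' is false (i.e. some $E\subseteq\mathbb{Z}_p^d$ violates it) for every odd prime $p$ and every $d\ge5$; it is true (i.e. holds for all nonempty $E\subseteq\mathbb{Z}_p^d$) for every prime $p$ and every $d\le 2$; and for $p\equiv3\pmod 4$ it is false also in dimension $d=4$.
   Context: $\mathbb{Z}_p=\mathbb{Z}/p\mathbb{Z}$, $x\cdot y=\sum_i x_iy_i$ on $\mathbb{Z}_p^d$, and $\chi(u)=e^{2\pi i u/p}$. $E\subseteq\mathbb{Z}_p^d$ tiles if there is $A\subseteq\mathbb{Z}_p^d$ such that the translates $E+a$, $a\in A$, partition $\mathbb{Z}_p^d$. $E\subseteq\mathbb{Z}_p^d$ is a spectral set if there is $B\subseteq\mathbb{Z}_p^d$ such that the functions $x\mapsto\chi(b\cdot x)$, indexed by $b\in B$, form an orthogonal basis of $L^2(E)$, the space of functions $E\to\mathbb{C}$ with inner product $\langle f,g\rangle=\sum_{e\in E}f(e)\overline{g(e)}$. *)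

(* Defs.v *)
From HB Require Import structures.
From mathcomp Require Import all_boot all_order all_algebra.
From mathcomp Require Import complex.
From mathcomp Require Import reals trigo.

Set Implicit Arguments.
Unset Strict Implicit.
Unset Printing Implicit Defensive.

Import Order.TTheory GRing.Theory Num.Theory.

Local Open Scope ring_scope.

(* [Zpd p d] is only used for prime [p], where ['F_p] is Z/pZ. *)
Notation Zpd p d := 'rV['F_p]_d.

Definition dotp (p d : nat) (x y : Zpd p d) : 'F_p :=
  \sum_(i < d) x ord0 i * y ord0 i.

(* e^{2 pi i u / p}, with [u] read as its representative in {0, ..., p - 1}. *)
Definition chi (R : realType) (p : nat) (u : 'F_p) : R[i] :=
  let t := 2 * pi * (u : nat)%:R / p%:R in (cos t +i* sin t)%C.

Definition translate (p d : nat) (E : {set Zpd p d}) (a : Zpd p d) :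
  {set Zpd p d} := [set x + a | x in E].

(* [partition] sees only the set of translates; injectivity makes the family
   indexed by [A] pairwise disjoint. *)
Definition tiles (p d : nat) (E : {set Zpd p d}) : Prop :=
  exists A : {set Zpd p d},
    {in A &, injective (translate E)} /\
    partition [set translate E a | a in A] [set: Zpd p d].

Definition L2 (R : realType) (p d : nat) (E : {set Zpd p d}) :=
  {ffun {x : Zpd p d | x \in E} -> R[i]^o}.

Definition inner (R : realType) (p d : nat) (E : {set Zpd p d})
  (f g : L2 R E) : R[i] := \sum_e f e * (g e)^*.

Definition chiL2 (R : realType) (p d : nat) (E : {set Zpd p d})
  (b : Zpd p d) : L2 R E := [ffun x => chi R (dotp b (val x))].

Definition spectral (R : realType) (p d : nat) (E : {set Zpd p d}) : Prop :=
  exists B : {set Zpd p d},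
    basis_of fullv [seq chiL2 R E b | b <- enum B] /\
    {in B &, forall b b', b != b' -> inner (chiL2 R E b) (chiL2 R E b') = 0}.

(* Main.v *)
Require Import Defs.
From mathcomp Require Import all_boot all_order all_algebra all_field.
From mathcomp Require Import complex.
From mathcomp Require Import reals trigo.
From mathcomp Require Import ring lra.

(** Write [charsum E c] for the sum of [chi (c . x)] over [x] in [E]. Since
    the space of functions on [E] has dimension [#|E|], the set [E] is
    spectral exactly when some [B] of the same size as [E] satisfies [charsum
    E (b - b') = 0] for all distinct [b], [b'] in [B] ([spectral_charsumP]).

    Counterexamples. A tiling set has a size dividing [p ^ d]
    ([tiles_dvdn_card]), so for odd [p] no set of size [2 p] tiles. One
    construction, in every dimension [d >= 4] and for every odd prime [p],
    gives all the counterexamples ([spectral_not_tiling]). Both [E] and [B]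
    consist of two families indexed by [F_p]; for [b] of index [i] in the
    family [s] and [e] of index [j] in the family [t], [b . e] is the sum of a
    bilinear term [m_st i j] and of multiples of [i ^ 2] and [j ^ 2] with
    coefficients depending on [s] and [t], the term in [i ^ 2] being absent
    for the first [t] and the term in [j ^ 2] for the first [s]. Two
    frequencies of the same family differ by an affine function of [j], of
    nonzero slope, on each half of [E], so the character sum vanishes on each
    half. Two frequencies of different families differ by [j ^ 2 - g] on one
    half and [nu j ^ 2 - g] on the other, after completing the squares, with
    [nu] not a square and with the same [g]. As every nonzero value is either
    a square or [nu] times a square, the two quadratics together take each
    value exactly twice ([sum_squares_nonsquares]), and the character sum
    vanishes again. Arranging that [g] is the same on both halves is what
    determines the coefficients; four coordinates are enough to realise the
    resulting array.

    Dimension at most 2. A vanishing rational combination of the powers [z ^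
    i], [i < p], of a primitive [p]-th root of unity has all its coefficients
    equal ([vanishing_sum_rat]), because the cyclotomic polynomial is
    irreducible. Hence [charsum E c = 0] forces [x |-> c . x] to take all
    values equally often on [E] ([charsum0_equidistributed]), and the
    character sum then vanishes at all nonzero multiples of [c]. A spectral
    set with at least two points thus has size divisible by [p]. If its size
    exceeds [p ^ (d - 1)], so does that of [B], hence for any given [c <> 0]
    two points of [B] differ by a nonzero multiple of [c]; all nontrivial
    character sums of [E] vanish, and [E] is the whole space
    ([spectral_large_full]). If its size is exactly [p], then [E] meets each
    of the parallel hyperplanes [c . x = u] once, and [E] tiles by the
    translations along the hyperplane [c . x = 0]. A single point tiles too,
    and for [d <= 2] there is no other case. *)

Set Implicit Arguments.
Unset Strict Implicit.
Unset Printing Implicit Defensive.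

Import Order.TTheory GRing.Theory Num.Theory.

Local Open Scope ring_scope.

(** * Vanishing sums of roots of unity *)

Lemma sum_expr_eq0 (F : idomainType) (z : F) (n : nat) :
  z != 1 -> (\sum_(i < n) z ^+ i == 0) = (z ^+ n == 1).
Proof.
move=> z1; rewrite -(subr_eq0 (z ^+ n)) subrX1 mulf_eq0 subr_eq0.
by rewrite (negbTE z1).
Qed.

Lemma prime_primitive_root (F : idomainType) (z : F) (p : nat) :
  prime p -> z ^+ p = 1 -> z != 1 -> p.-primitive_root z.
Proof.
move=> p_pr zp1 z1.
have [m m_prim m_dvd] := prim_order_exists (prime_gt0 p_pr) zp1.
have [_ /(_ m m_dvd)] := primeP p_pr.
case/orP=> [/eqP m1|/eqP <- //].
by move: (prim_expr_order m_prim) z1; rewrite m1 expr1 => ->; rewrite eqxx.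
Qed.

(** The polynomial [P] with coefficients [c i] shares the root [z] with
    [Q = 1 + X + ... + X^(p-1)], so their gcd over the rationals is not
    constant.  It then has a root in [algC], which is a primitive [p]-th root of
    unity whose minimal polynomial, of degree [p - 1], divides both [P] and
    [Q].  So [P] is a constant multiple of [Q]. *)
Lemma vanishing_sum_rat (K : numFieldType) (z : K) (p : nat) (c : nat -> rat) :
  prime p -> p.-primitive_root z ->
  \sum_(i < p) ratr (c i) * z ^+ i = 0 ->
  forall i j, (i < p)%N -> (j < p)%N -> c i = c j.
Proof.
move=> p_pr z_prim sum0.
have p_gt0 := prime_gt0 p_pr; have p_gt1 := prime_gt1 p_pr.
pose P : {poly rat} := \poly_(i < p) c i.
pose Q : {poly rat} := \poly_(i < p) 1.
have sizeQ : size Q = p by rewrite size_poly_eq ?oner_eq0.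
have Q0 : Q != 0 by rewrite -size_poly_eq0 sizeQ -lt0n.
have evalP (L : numFieldType) (x : L) :
    (map_poly ratr P).[x] = \sum_(i < p) ratr (c i) * x ^+ i.
  rewrite (@horner_coef_wide _ p) ?size_map_poly ?size_poly //.
  by apply: eq_bigr => i _; rewrite coef_map coef_poly ltn_ord.
have evalQ (L : numFieldType) (x : L) :
    (map_poly ratr Q).[x] = \sum_(i < p) x ^+ i.
  rewrite (@horner_coef_wide _ p) ?size_map_poly ?size_poly //.
  by apply: eq_bigr => i _; rewrite coef_map coef_poly ltn_ord /= rmorph1 mul1r.
have z1 : z != 1.
  by rewrite -[z]expr1 -(prim_order_dvd z_prim) dvdn1 gtn_eqF.
have rootP : root (map_poly ratr P) z by rewrite /root evalP sum0.
have rootQ : root (map_poly ratr Q) z.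
  by rewrite /root evalQ sum_expr_eq0 // (prim_expr_order z_prim).
pose D := gcdp P Q.
have D0 : D != 0 by rewrite gcdp_eq0 negb_and Q0 orbT.
have rootD : root (map_poly ratr D) z.
  by rewrite gcdp_map root_gcd rootP rootQ.
(* passing through the gcd moves the common root from [K] to [algC], where
   the minimal polynomial of a root of unity is cyclotomic *)
have sizeD : size (map_poly ratr D : {poly algC}) != 1%N.
  have := root_size_gt1 _ rootD; rewrite map_poly_eq0 => /(_ D0).
  by rewrite !size_map_poly neq_ltn orbC => ->.
have [x] := closed_rootP _ sizeD.
rewrite gcdp_map root_gcd => /andP[rootPx rootQx].
have x1 : x != 1.
  apply: contraTneq rootQx => ->; rewrite /root evalQ.
  under eq_bigr do rewrite expr1n.
  by rewrite sumr_const card_ord pnatr_eq0 -lt0n.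
have xp1 : x ^+ p = 1.
  by apply/eqP; rewrite -sum_expr_eq0 // -evalQ.
have x_prim : p.-primitive_root x by apply: prime_primitive_root.
have [q [minq q_monic] dvd_q] := minCpolyP x.
have sizeq : size q = p.
  have := congr1 (fun r : {poly algC} => size r) minq.
  rewrite size_map_poly (minCpoly_cyclotomic x_prim) size_cyclotomic => <-.
  by rewrite totient_prime // prednK.
have QdvdP : Q %| P.
  have /eqp_dvdl <- : q %= Q by rewrite -dvdp_size_eqp ?sizeq ?sizeQ -?dvd_q.
  by rewrite -dvd_q.
have quo_const : (size (P %/ Q)%R <= 1)%N.
  rewrite size_divp // sizeQ leq_subLR addn1 prednK //.
  exact: size_poly.
have coefP i : (i < p)%N -> c i = (P %/ Q)`_0.
  move=> ip; have := congr1 (fun r : {poly rat} => r`_i) (divpK QdvdP).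
  by rewrite (size1_polyC quo_const) coefCM !coef_poly ip mulr1 coefC eqxx.
by move=> i j ip jp; rewrite !coefP.
Qed.

(** * The additive character of F_p *)

Lemma cisX (R : realType) (t : R) (n : nat) :
  (cos t +i* sin t)%C ^+ n = (cos (t *+ n) +i* sin (t *+ n))%C.
Proof.
elim: n => [|n IHn]; first by rewrite mulr0n cos0 sin0.
rewrite exprS IHn mulrS cosD sinD; congr (_ +i* _)%C.
by rewrite addrC [sin t * _]mulrC.
Qed.

Lemma chi_exp (R : realType) (p : nat) (u : 'F_p) :
  chi R u = chi R (1 : 'F_p) ^+ u.
Proof.
rewrite /chi cisX (_ : ((1%R : 'F_p) : nat) = 1%N) //.
have -> : 2 * pi * u%:R / p%:R = (2 * pi * 1%:R / p%:R) *+ u :> R.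
  by rewrite -[RHS]mulr_natr; ring.
by [].
Qed.

Lemma chi1_primitive (R : realType) (p : nat) :
  prime p -> p.-primitive_root (chi R (1 : 'F_p)).
Proof.
move=> p_pr; have p_gt0 := prime_gt0 p_pr; have p_gt1 := prime_gt1 p_pr.
have pR_neq0 : p%:R != 0 :> R by rewrite pnatr_eq0 -lt0n.
have v1 : ((1%R : 'F_p) : nat) = 1%N by [].
set z := chi R 1.
have zp1 : z ^+ p = 1.
  rewrite /z /chi cisX v1.
  have -> : (2 * pi * 1%:R / p%:R) *+ p = pi *+ 2 :> R.
    by rewrite -[LHS]mulr_natr -[RHS]mulr_natr; field.
  by rewrite cos2pi sin2pi.
apply: prime_primitive_root => //; apply/eqP => z1.
(* with [t = pi / p] in ]0, pi[, [cos (2 t) = 1] would force [sin t = 0] *)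
pose t : R := pi / p%:R.
have t_bnd : 0 < t < pi.
  rewrite divr_gt0 ?pi_gt0 ?ltr0n //= ltr_pdivrMr ?ltr0n //.
  by rewrite ltr_pMr ?pi_gt0 // ltr1n.
have cos1 : cos (t *+ 2) = 1.
  have := z1; rewrite /z /chi v1.
  have -> : 2 * pi * 1%:R / p%:R = t *+ 2 by rewrite -[RHS]mulr_natr /t; ring.
  by case.
have sin0 : sin t ^+ 2 = 0.
  by move: cos1; rewrite cos_mulr2n cos2sin2 -mulr_natr => cos1; lra.
have := sin_gt0_pi t_bnd.
by rewrite lt0r -sqrf_eq0 sin0 eqxx.
Qed.

Lemma chi_eq1 (R : realType) (p : nat) (u : 'F_p) :
  prime p -> (chi R u == 1) = (u == 0).
Proof.
move=> p_pr; rewrite chi_exp -(prim_order_dvd (chi1_primitive R p_pr)).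
have ltup : (u < p)%N by rewrite -[X in (_ < X)%N](Fp_cast p_pr).
by rewrite /dvdn modn_small.
Qed.

Lemma chi0 (R : realType) (p : nat) : chi R (0 : 'F_p) = 1.
Proof. by rewrite chi_exp. Qed.

Lemma chiD (R : realType) (p : nat) (u v : 'F_p) :
  prime p -> chi R (u + v) = chi R u * chi R v.
Proof.
move=> p_pr; rewrite (chi_exp R (u + v)) (chi_exp R u) (chi_exp R v) -exprD.
rewrite -[RHS](prim_expr_mod (chi1_primitive R p_pr)) /=.
by rewrite [X in (_ %% X)%N](Fp_cast p_pr).
Qed.

Lemma chi_conj (R : realType) (p : nat) (u : 'F_p) :
  prime p -> (chi R u)^* = chi R (- u).
Proof.
move=> p_pr.
have h : chi R u * chi R (- u) = 1 by rewrite -chiD // subrr chi0.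
have h' : chi R u * (chi R u)^* = 1.
  rewrite /chi; set t := (X in cos X).
  have -> : ((cos t +i* sin t)%C : R[i])^* = (cos t +i* - sin t)%C by [].
  apply/eqP; rewrite eq_complex /= mulrN opprK -!expr2 cos2Dsin2 eqxx /=.
  by rewrite mulrN mulrC addNr.
have u0 : chi R u != 0.
  by apply/eqP => E; move/eqP: h; rewrite E mul0r eq_sym oner_eq0.
by apply: (mulfI u0); rewrite h h'.
Qed.

(** Translating the summation variable by 1 multiplies the sum by
    [chi 1], which is not 1. *)
Lemma sum_chi (R : realType) (p : nat) : prime p -> \sum_(u : 'F_p) chi R u = 0.
Proof.
move=> p_pr; apply/eqP; set S := \sum_u _.
have : chi R (1 : 'F_p) * S = S.
  rewrite mulr_sumr /S [RHS](reindex_inj (addrI 1)).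
  by apply: eq_bigr => u _; rewrite chiD.
move/eqP; rewrite -subr_eq0 -{2}[S]mul1r -mulrBl mulf_eq0 subr_eq0.
by rewrite chi_eq1 // oner_eq0.
Qed.

Lemma sum_chi_affine (R : realType) (p : nat) (a b : 'F_p) :
  prime p -> a != 0 -> \sum_(u : 'F_p) chi R (a * u + b) = 0.
Proof.
move=> p_pr a0; rewrite -[RHS](sum_chi R p_pr) [RHS](reindex_inj (addIr b)).
by rewrite [RHS](reindex_inj (mulfI a0)).
Qed.

(** * Character sums over subsets of F_p^d *)

Lemma dotp_mx (p d : nat) (x y : Zpd p d) : dotp x y = (x *m y^T) ord0 ord0.
Proof. by rewrite mxE; apply: eq_bigr => i _; rewrite mxE. Qed.

Lemma dotpC (p d : nat) (x y : Zpd p d) : dotp x y = dotp y x.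
Proof. by apply: eq_bigr => i _; rewrite mulrC. Qed.

Lemma dotpDl (p d : nat) (x x' y : Zpd p d) :
  dotp (x + x') y = dotp x y + dotp x' y.
Proof. by rewrite !dotp_mx mulmxDl mxE. Qed.

Lemma dotpNl (p d : nat) (x y : Zpd p d) : dotp (- x) y = - dotp x y.
Proof. by rewrite !dotp_mx mulNmx mxE. Qed.

Lemma dotpDr (p d : nat) (x y y' : Zpd p d) :
  dotp x (y + y') = dotp x y + dotp x y'.
Proof. by rewrite dotpC dotpDl !(dotpC x). Qed.

Lemma dotpNr (p d : nat) (x y : Zpd p d) : dotp x (- y) = - dotp x y.
Proof. by rewrite dotpC dotpNl dotpC. Qed.

Lemma dotpZl (p d : nat) (a : 'F_p) (x y : Zpd p d) :
  dotp (a *: x) y = a * dotp x y.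
Proof. by rewrite !dotp_mx -scalemxAl mxE. Qed.

Lemma sum_chi_dotp (R : realType) (p d : nat) (x : Zpd p d) :
  prime p -> x != 0 -> \sum_(c : Zpd p d) chi R (dotp c x) = 0.
Proof.
move=> p_pr x0; apply/eqP.
have [i xi0] : exists i, x ord0 i != 0.
  apply/existsP; apply: contraR x0 => /existsPn x_eq0.
  by apply/eqP/rowP => i; rewrite mxE; apply/eqP/negbNE/x_eq0.
pose c0 : Zpd p d := delta_mx ord0 i.
have c0x : dotp c0 x = x ord0 i.
  by rewrite dotp_mx -rowE !mxE.
set S := \sum_c _.
have : chi R (dotp c0 x) * S = S.
  rewrite mulr_sumr /S [RHS](reindex_inj (addrI c0)).
  by apply: eq_bigr => u _; rewrite dotpDl chiD.
move/eqP; rewrite -subr_eq0 -{2}[S]mul1r -mulrBl mulf_eq0 subr_eq0.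
by rewrite c0x chi_eq1 // (negbTE xi0).
Qed.

(** Up to conjugation, the Fourier transform at [c] of the indicator function
    of [E]. *)
Definition charsum (R : realType) (p d : nat) (E : {set Zpd p d})
  (c : Zpd p d) : R[i] := \sum_(x in E) chi R (dotp c x).

Lemma charsumN (R : realType) (p d : nat) (E : {set Zpd p d}) (c : Zpd p d) :
  prime p -> charsum R E (- c) = (charsum R E c)^*.
Proof.
move=> p_pr; rewrite /charsum rmorph_sum.
by apply: eq_bigr => x _; rewrite dotpNl -chi_conj.
Qed.

Lemma inner_chi (R : realType) (p d : nat) (E : {set Zpd p d})
    (b b' : Zpd p d) :
  prime p -> inner (chiL2 R E b) (chiL2 R E b') = charsum R E (b - b').
Proof.
move=> p_pr; rewrite /charsum big_sub; apply: eq_bigr => x _.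
by rewrite !ffunE chi_conj // -chiD // dotpDl dotpNl.
Qed.

(** The dimension of [L2 R E] is [#|E|], and orthogonal nonzero vectors are
    linearly independent. *)
Lemma spectral_charsumP (R : realType) (p d : nat) (E : {set Zpd p d}) :
  prime p ->
  spectral R E <->
  exists B : {set Zpd p d}, #|B| = #|E| /\
    {in B &, forall b b', b != b' -> charsum R E (b - b') = 0}.
Proof.
move=> p_pr.
have dimL2 : \dim {: L2 R E} = #|E| by rewrite dimvf /dim /= muln1 card_sig.
split=> [[B [B_basis B_orth]]|[B [cardB B_orth]]].
  exists B; split=> [|b b' bB b'B bb']; last by rewrite -inner_chi ?B_orth.
  by rewrite -dimL2 (size_basis (X := in_tuple _) B_basis) size_map -cardE.
exists B; split=> [|b b' bB b'B bb']; last by rewrite inner_chi ?B_orth.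
rewrite basisEfree subvf dimL2 size_map -cardE cardB leqnn !andbT.
set X := map _ _.
have sizeX : size X = #|B| by rewrite size_map -cardE.
pose b_ (i : 'I_(size X)) := nth 0 (enum B) i.
have ltB (i : 'I_(size X)) : (i < size (enum B))%N by rewrite -cardE -sizeX.
have bB i : b_ i \in B by rewrite -mem_enum mem_nth.
apply/(freeP (X := in_tuple X)) => k k_rel i.
have X_nth (j : 'I_(size X)) : (in_tuple X)`_j = chiL2 R E (b_ j).
  by rewrite (nth_map 0).
have : inner (\sum_(j < size X) k j *: (in_tuple X)`_j) (chiL2 R E (b_ i)) = 0.
  by rewrite k_rel /inner big1 // => e _; rewrite ffunE mul0r.
have -> : inner (\sum_(j < size X) k j *: (in_tuple X)`_j) (chiL2 R E (b_ i)) =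
    \sum_(j < size X) k j * charsum R E (b_ j - b_ i).
  under [RHS]eq_bigr do rewrite -inner_chi // mulr_sumr.
  rewrite exchange_big; apply: eq_bigr => e _.
  rewrite sum_ffunE mulr_suml; apply: eq_bigr => j _.
  by rewrite X_nth ffunE mulrA.
rewrite (bigD1 i) //= big1 => [|j ji]; last first.
  by rewrite B_orth ?mulr0 ?bB // nth_uniq ?enum_uniq ?ltB //.
rewrite addr0 subrr => /eqP; rewrite mulf_eq0 => /orP[/eqP //|].
rewrite /charsum; under eq_bigr do rewrite dotp_mx mul0mx mxE chi0.
rewrite sumr_const pnatr_eq0 -cardB -sizeX => /eqP s0.
by have := ltn_ord i; rewrite [X in (_ < X)%N]s0.
Qed.

Lemma sum_fibers (I J : finType) (V : nmodType) (A : {set I}) (g : I -> J)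
    (f : J -> V) :
  \sum_(x in A) f (g x) = \sum_v f v *+ #|[set x in A | g x == v]|.
Proof.
rewrite (partition_big g predT) //=; apply: eq_bigr => v _.
rewrite (eq_bigr (fun=> f v)) => [|x /andP[_ /eqP->] //].
by rewrite sumr_const; congr (_ *+ _); apply: eq_card => x; rewrite !inE.
Qed.

Lemma sum_Fp (V : nmodType) (p : nat) (F : nat -> V) :
  prime p -> \sum_(i < p) F i = \sum_(u : 'F_p) F u.
Proof. by move=> p_pr; rewrite -!(big_mkord xpredT F) Fp_cast. Qed.

(** Grouping the terms of the character sum by the value of [c . x] gives a
    vanishing rational combination of the powers of [chi 1], so the numbers of
    points of [E] on the hyperplanes [c . x = u] are all equal. *)
Lemma charsum0_equidistributed (R : realType) (p d : nat) (E : {set Zpd p d})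
    (c : Zpd p d) :
  prime p -> charsum R E c = 0 ->
  forall u, (p * #|[set x in E | dotp c x == u]|)%N = #|E|.
Proof.
move=> p_pr sum0.
pose N u := #|[set x in E | dotp c x == u]|.
have val_lt (u : 'F_p) : (u < p)%N by rewrite -[X in (_ < X)%N](Fp_cast p_pr).
have rat_sum : \sum_(i < p) ratr (N i%:R)%:R * chi R (1 : 'F_p) ^+ i = 0.
  rewrite -[RHS]sum0 /charsum (sum_fibers E (dotp c) (@chi R p)).
  rewrite (sum_Fp (fun i => ratr (N i%:R)%:R * chi R (1 : 'F_p) ^+ i)) //.
  apply: eq_bigr => u _.
  by rewrite ratr_nat -chi_exp natr_Zp mulr_natl.
have N_const u v : N u = N v.
  have := vanishing_sum_rat (c := fun i => (N i%:R)%:R) p_pr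
    (chi1_primitive R p_pr) rat_sum (val_lt u) (val_lt v).
  by rewrite !natr_Zp => /eqP; rewrite eqr_nat => /eqP.
move=> u; rewrite -[in RHS]sum1_card (sum_fibers E (dotp c) (fun=> 1%N)).
rewrite (eq_bigr (fun=> N u)) => [|v _]; last by rewrite natn (N_const u v).
by rewrite sum_nat_const card_Fp.
Qed.

Lemma charsum0_scale (R : realType) (p d : nat) (E : {set Zpd p d})
    (c : Zpd p d) (a : 'F_p) :
  prime p -> a != 0 -> charsum R E c = 0 -> charsum R E (a *: c) = 0.
Proof.
move=> p_pr a0 /(charsum0_equidistributed p_pr) equi; rewrite /charsum.
under eq_bigr do rewrite dotpZl.
rewrite (sum_fibers E (dotp c) (fun u => chi R (a * u))).
rewrite (eq_bigr
    (fun u => chi R (a * u + 0) *+ #|[set x in E | dotp c x == 0]|)).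
  by rewrite sumrMnl sum_chi_affine ?mul0rn.
move=> u _; rewrite addr0; congr (_ *+ _).
by apply/eqP; rewrite -(eqn_pmul2l (prime_gt0 p_pr)) !equi.
Qed.

(** * Tilings *)

Lemma tiles_direct (p d : nat) (E A : {set Zpd p d}) :
  E != set0 ->
  (forall y, exists2 a, a \in A & y - a \in E) ->
  {in A & A, forall a a', forall x x', x \in E -> x' \in E ->
     x + a = x' + a' -> a = a'} ->
  tiles E.
Proof.
move=> /set0Pn[e eE] cov disj; exists A; split=> [a a' aA a'A eqT|].
  have : e + a \in translate E a' by rewrite -eqT; apply: imset_f.
  by case/imsetP => e' e'E; apply: disj.
apply/and3P; split.
- apply/eqP/setP => y; rewrite in_setT; have [a aA yaE] := cov y.
  apply/bigcupP; exists (translate E a); first exact: imset_f.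
  by rewrite -[y](subrK a); apply: imset_f.
- apply/trivIsetP => _ _ /imsetP[a aA ->] /imsetP[a' a'A ->] ne.
  apply/pred0P => y /=; apply/negP => /andP[].
  move=> /imsetP[x xE ->] /imsetP[x' x'E eqy].
  by move/eqP: ne; rewrite (disj a a' aA a'A x x').
apply/negP => /imsetP[a aA] /esym /eqP; rewrite imset_eq0 => /eqP E0.
by rewrite E0 inE in eE.
Qed.

Lemma tiles_dvdn_card (p d : nat) (E : {set Zpd p d}) :
  prime p -> tiles E -> (#|E| %| p ^ d)%N.
Proof.
move=> p_pr [A [_ part]].
have cardT : forall X, X \in [set translate E a | a in A] -> #|X| = #|E|.
  by move=> _ /imsetP[a aA ->]; rewrite card_imset //; apply: addIr.
have := card_uniform_partition cardT part.
rewrite cardsT card_mx card_Fp // mul1n => ->; exact: dvdn_mull.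
Qed.

(** * Spectral sets tile in dimension at most 2 *)

(** The map [(l, b) |-> b + l c] from [F_p * B] to [F_p^d] cannot be injective;
    a collision puts [c] on the line spanned by a difference of points of
    [B]. *)
Lemma pigeonhole_direction (p d : nat) (B : {set Zpd p d}) (c : Zpd p d) :
  prime p -> (p ^ d < p * #|B|)%N -> c != 0 ->
  exists b b' a, [/\ b \in B, b' \in B, b != b', a != 0 & c = a *: (b - b')].
Proof.
move=> p_pr B_large c0.
pose f (x : 'F_p * Zpd p d) := x.2 + x.1 *: c.
pose D := setX [set: 'F_p] B.
have /dinjectivePn[[l b] lbD [[l' b'] + eqf]] : ~~ dinjectiveb f D.
  apply: contraL B_large => /dinjectiveP f_inj; rewrite -leqNgt.
  have := max_card (f @: D).
  by rewrite card_in_imset // cardsX cardsT card_mx card_Fp // mul1n.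
move: lbD; rewrite !inE /= => bB /andP[ne b'B].
have eqb : b - b' = (l' - l) *: c.
  move: eqf; rewrite /f /= scalerBl => /(congr1 (fun x => x - b' - l *: c)).
  by rewrite addrAC addrK [b' + _]addrC addrK.
have ll' : l' - l != 0.
  apply: contraNneq ne => ll'; move: eqb.
  rewrite ll' scale0r => /eqP; rewrite subr_eq0 => /eqP ->.
  by move/eqP: ll'; rewrite subr_eq0 => /eqP ->.
exists b, b', (l' - l)^-1; split; rewrite ?invr_eq0 //.
  by rewrite -subr_eq0 eqb scaler_eq0 negb_or ll' c0.
by rewrite eqb scalerA mulVf ?scale1r.
Qed.

(** Fourier inversion: if [x] is not in [E], summing [chi (c . (e - x))] over
    all [c] and all [e] in [E] gives 0, whereas only [c = 0] contributes, with
    the value [#|E|]. *)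
Lemma charsum0_full (R : realType) (p d : nat) (E : {set Zpd p d}) :
  prime p -> E != set0 -> (forall c, c != 0 -> charsum R E c = 0) ->
  E = [set: Zpd p d].
Proof.
move=> p_pr E0 sum0; apply/setP => x; rewrite in_setT.
apply: contraNT E0 => xE; rewrite -cards_eq0 -(pnatr_eq0 R[i]).
have double : \sum_(e in E) \sum_c chi R (dotp c (e - x)) = 0.
  apply: big1 => e eE; apply: sum_chi_dotp => //.
  by rewrite subr_eq0; apply: contraTneq eE => ->.
rewrite exchange_big (bigD1 0) //= [X in _ + X]big1 in double; last first.
  move=> c c0; have := sum0 c c0; rewrite /charsum.
  under [X in _ -> X = _]eq_bigr do rewrite dotpDr chiD //.
  by rewrite -mulr_suml => ->; rewrite mul0r.
move: double; under eq_bigr do rewrite dotp_mx mul0mx mxE chi0.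
by rewrite sumr_const addr0 => ->.
Qed.

Lemma spectral_large_full (R : realType) (p d : nat) (E : {set Zpd p d}) :
  prime p -> spectral R E -> (p ^ d < p * #|E|)%N -> E = [set: Zpd p d].
Proof.
move=> p_pr /(spectral_charsumP R E p_pr)[B [cardB B_orth]] E_large.
apply: (charsum0_full (R := R)) => // [|c c0].
  by rewrite -card_gt0; case: #|E| E_large => //; rewrite muln0.
rewrite -cardB in E_large.
have [b [b' [a [bB b'B bb' a0 ->]]]] := pigeonhole_direction p_pr E_large c0.
by rewrite charsum0_scale ?B_orth.
Qed.

Lemma spectral_equidistributed (R : realType) (p d : nat) (E : {set Zpd p d}) :
  prime p -> spectral R E -> (1 < #|E|)%N ->
  exists c : Zpd p d, forall u, (p * #|[set x in E | dotp c x == u]|)%N = #|E|.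
Proof.
move=> p_pr /(spectral_charsumP R E p_pr)[B [cardB B_orth]].
rewrite -[X in (_ < X)%N]cardB => /card_gt1P[b [b' [bB b'B bb']]].
exists (b - b') => u.
apply: (charsum0_equidistributed (R := R)) => //; exact: B_orth.
Qed.

Lemma spectral_tiles_dim_le2 (R : realType) (p d : nat) (E : {set Zpd p d}) :
  prime p -> (d <= 2)%N -> E != set0 -> spectral R E -> tiles E.
Proof.
move=> p_pr d2 E0 E_spec; have p_gt0 := prime_gt0 p_pr.
have [E1|E_gt1] := leqP #|E| 1.
  have /cards1P[e Ee] : #|E| == 1%N by rewrite eqn_leq E1 card_gt0.
  apply: (tiles_direct (A := [set: Zpd p d])) => // [y|a a' _ _ x x'].
    by exists (y - e); rewrite ?inE // opprB addrC subrK Ee set11.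
  by rewrite Ee !inE => /eqP-> /eqP-> /addrI.
have [E_large|] := ltnP (p ^ d) (p * #|E|).
  apply: (tiles_direct (A := [set 0])) => // [y|a a'].
    by exists 0; rewrite ?set11 // (spectral_large_full p_pr E_spec) ?inE.
  by rewrite !inE => /eqP-> /eqP->.
move=> E_small.
(* what remains is [#|E| = p] with one point on each line [c . x = u] *)
have [c equi] := spectral_equidistributed p_pr E_spec E_gt1.
have cardE : #|E| = p.
  apply/eqP; rewrite eqn_leq; apply/andP; split.
    rewrite -(leq_pmul2l p_gt0); apply: leq_trans E_small _.
    by rewrite mulnn leq_exp2l // prime_gt1.
  rewrite -(equi 0) leq_pmulr // lt0n; apply: contraTneq E_gt1 => N0.
  by rewrite -(equi 0) N0 muln0.
have fiber1 u : exists e, [set x in E | dotp c x == u] = [set e].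
  by apply/cards1P; rewrite -(eqn_pmul2l p_gt0) muln1 equi cardE.
apply: (tiles_direct (A := [set a | dotp c a == 0])) => // [y|a a'].
  have [e /setP/(_ e)] := fiber1 (dotp c y); rewrite !inE eqxx.
  move=> /andP[eE /eqP ce].
  exists (y - e); last by rewrite opprB addrC subrK.
  by rewrite inE dotpDr dotpNr ce subrr.
rewrite !inE => /eqP ca /eqP ca' x x' xE x'E eqy.
have [e /setP fib] := fiber1 (dotp c x).
have : x == e by have := fib x; rewrite !inE xE eqxx => <-.
have : x' == e.
  have := fib x'; rewrite !inE x'E => <- /=.
  by have := congr1 (dotp c) eqy; rewrite !dotpDr ca ca' !addr0 => ->.
by move=> /eqP x'e /eqP xe; move: eqy; rewrite x'e xe => /addrI.
Qed.

(** * A spectral set of size 2p in dimension at least 4 *)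

(** Squaring is not injective, as [1] and [-1] have the same square, hence not
    surjective. *)
Lemma exists_nonsquare (F : finFieldType) :
  2 != 0 :> F -> exists nu : F, forall x, x ^+ 2 != nu.
Proof.
move=> two0; pose sq (x : F) := x ^+ 2.
have [/forallP all_sq|/forallPn[nu /existsPn nu_nsq]] :=
  boolP [forall v, [exists x, sq x == v]]; last by exists nu.
have : #|sq @: [set: F]| == #|[set: F]|.
  rewrite cardsT; apply/eqP/eq_card => v; rewrite !inE.
  by apply/imsetP; have /existsP[x /eqP <-] := all_sq v; exists x.
move=> /imset_injP/(_ 1 (-1)); rewrite !inE /sq sqrrN => /(_ isT isT erefl).
by move/eqP; rewrite -subr_eq0 opprK (negbTE two0).
Qed.

(** A value [v] is taken by [j ^ 2] and [nu * j ^ 2] at most twice in total: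
    if both took a nonzero value [v], then [nu] would be a square.  The total
    number of values is [2 * #|F|], so each is taken exactly twice. *)
Lemma sum_squares_nonsquares (F : finFieldType) (V : nmodType) (nu : F)
    (f : F -> V) :
  (forall x, x ^+ 2 != nu) ->
  \sum_j f (j ^+ 2) + \sum_j f (nu * j ^+ 2) = (\sum_v f v) *+ 2.
Proof.
move=> nu_nsq; have nu0 : nu != 0.
  by have := nu_nsq 0; rewrite expr0n eq_sym.
pose N v := #|[set j in [set: F] | j ^+ 2 == v]|.
pose N' v := #|[set j in [set: F] | nu * j ^+ 2 == v]|.
have le2 v : (N v + N' v <= 2)%N.
  have card_sym (A : {set F}) :
      {in A &, forall j k, j ^+ 2 = k ^+ 2} -> (#|A| <= 2)%N.
    move=> sqA; have [->|/set0Pn[k kA]] := eqVneq A set0.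
      by rewrite cards0.
    have /subset_leq_card : A \subset [set k; - k].
      by apply/subsetP => j jA; rewrite !inE -eqf_sqr (sqA j k).
    by move=> h; apply: leq_trans h _; rewrite cards2; case: (_ != _).
  have le1 (A : {set F}) : (forall j, j \in A -> j = 0) -> (#|A| <= 1)%N.
    move=> A0; rewrite -(cards1 (0 : F)); apply/subset_leq_card/subsetP => j jA.
    by rewrite inE (A0 j jA).
  have [->|v0] := eqVneq v 0.
    apply: (@leq_add _ _ 1 1); apply: le1 => j; rewrite !inE /=.
      by rewrite sqrf_eq0 => /eqP.
    by rewrite mulf_eq0 (negbTE nu0) sqrf_eq0 => /eqP.
  have [[k /eqP kv]|no_sq] := altP (@existsP _ (fun k => k ^+ 2 == v)).
    have -> : N' v = 0%N.
      apply/eqP; rewrite cards_eq0; apply/eqP/setP => j; rewrite !inE.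
      apply/negP => /eqP jv; have j0 : j != 0.
        by apply: contraNneq v0 => j0; rewrite -jv j0 expr0n mulr0.
      have /eqP := nu_nsq (k / j); apply.
      by rewrite expr_div_n kv -jv mulfK // expf_neq0.
    rewrite addn0; apply: card_sym => i j.
    by rewrite !inE => /eqP-> /eqP->.
  have -> : N v = 0%N.
    apply/eqP; rewrite cards_eq0; apply/eqP/setP => j; rewrite !inE.
    by apply: contraNF no_sq => jv; apply/existsP; exists j.
  rewrite add0n; apply: card_sym => i j.
  by rewrite !inE => /eqP iv /eqP jv; apply: (mulfI nu0); rewrite iv jv.
have all2 v : (N v + N' v)%N = 2.
  have [_] := leqif_sum (fun v (_ : xpredT v) => leqif_eq (le2 v)).
  have cardF g : \sum_v #|[set j in [set: F] | g j == v]| = #|F|.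
    rewrite -cardsT -sum1_card (sum_fibers _ g (fun=> 1%N)).
    by apply: eq_bigr => u _; rewrite natn.
  rewrite big_split /= !cardF sum_nat_const addnn -muln2 eqxx.
  by move/esym/forallP/(_ v)/eqP.
have sumE (g : F -> F) : \sum_j f (g j) = \sum_(j in [set: F]) f (g j).
  by apply: eq_bigl => j; rewrite inE.
rewrite (sumE (fun j => j ^+ 2)) (sumE (fun j => nu * j ^+ 2)).
rewrite (sum_fibers _ _ f) (sum_fibers _ (fun j => nu * j ^+ 2) f).
rewrite -big_split /= -sumrMnl; apply: eq_bigr => v _.
by rewrite -mulrnDr all2.
Qed.

(** The coordinates beyond the fourth are the default 0 of [nth], which embeds
    the 4-dimensional construction in every larger dimension. *)
Definition vec4 (F : nzRingType) (d : nat) (x0 x1 x2 x3 : F) : 'rV[F]_d :=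
  \row_i nth 0 [:: x0; x1; x2; x3] i.

Lemma dotp_vec4 (p d : nat) (x0 x1 x2 x3 y0 y1 y2 y3 : 'F_p) :
  (4 <= d)%N ->
  dotp (vec4 d x0 x1 x2 x3) (vec4 d y0 y1 y2 y3) =
  x0 * y0 + x1 * y1 + x2 * y2 + x3 * y3.
Proof.
case: d => [|[|[|[|d]]]] // _; rewrite /dotp !big_ord_recl !mxE /=.
rewrite big1 => [|i _]; last by rewrite !mxE /= nth_nil mul0r.
by rewrite addr0 !addrA.
Qed.

Lemma vec4_inj (F : nzRingType) (d : nat) (x0 x1 x2 x3 y0 y1 y2 y3 : F) :
  (4 <= d)%N -> vec4 d x0 x1 x2 x3 = vec4 d y0 y1 y2 y3 ->
  [/\ x0 = y0, x1 = y1, x2 = y2 & x3 = y3].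
Proof.
case: d => [|[|[|[|d]]]] // _ /rowP eqv.
have coord (k : 'I_d.+4) := eqv k.
by split; [move: (coord (inord 0)) | move: (coord (inord 1))
  | move: (coord (inord 2)) | move: (coord (inord 3))]; rewrite !mxE inordK.
Qed.

(** With [frequency] below, the cross terms of [b . e] are [2 m_st i j] with
    [m_00 = m_01 = m_10 = 1] and [m_11 = nu].  The third coordinates give the
    difference between the two families of frequencies its quadratic part:
    [j ^ 2] on the first half, [nu j ^ 2] on the second. *)
Definition point (p d : nat) (nu : 'F_p) (jt : 'F_p * bool) : Zpd p d :=
  let j := jt.1 in
  if jt.2 then vec4 d (2 * j) (2 * nu * j) (nu * j ^+ 2) 1
  else vec4 d (2 * j) (2 * j) (j ^+ 2) 0.

(** The fourth coordinate meets only the second half of the points.  Its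
    coefficients make the quadratics in [j], obtained on the two halves from
    the frequencies [(i, false)] and [(i', true)], have the same constant term
    [- (i - i') ^ 2] after completing the squares. *)
Definition frequency (p d : nat) (nu : 'F_p) (js : 'F_p * bool) : Zpd p d :=
  let i := js.1 in
  if js.2 then vec4 d 0 i (-1) ((1 - nu) * i ^+ 2)
  else vec4 d i 0 0 ((nu^-1 - 1) * i ^+ 2).

Lemma point_inj (p d : nat) (nu : 'F_p) :
  (4 <= d)%N -> 2 != 0 :> 'F_p -> injective (point d nu).
Proof.
move=> d4 two0 [j t] [k u]; rewrite /point /=.
by case: t; case: u => /(vec4_inj d4)[/(mulfI two0) -> _ _ /eqP];
  rewrite ?(eq_sym 0) ?oner_eq0.
Qed.

Lemma frequency_inj (p d : nat) (nu : 'F_p) :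
  (4 <= d)%N -> injective (frequency d nu).
Proof.
move=> d4 [j t] [k u]; rewrite /frequency /=.
case: t; case: u => /(vec4_inj d4)[e0 e1 /eqP e2 _]; first by rewrite e1.
- by rewrite oppr_eq0 oner_eq0 in e2.
- by rewrite eq_sym oppr_eq0 oner_eq0 in e2.
by rewrite e0.
Qed.

Lemma charsum_point (R : realType) (p d : nat) (nu : 'F_p) c :
  (4 <= d)%N -> 2 != 0 :> 'F_p ->
  charsum R (point d nu @: setT) c =
  \sum_j chi R (dotp c (point d nu (j, false))) +
  \sum_j chi R (dotp c (point d nu (j, true))).
Proof.
move=> d4 two0; rewrite /charsum big_imset; last first.
  by move=> x y _ _; apply: point_inj.
under eq_bigl do rewrite inE.
rewrite (eq_bigr (fun jt => chi R (dotp c (point d nu (jt.1, jt.2)))));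
  last by case.
rewrite -(pair_bigA _ (fun j t => chi R (dotp c (point d nu (j, t))))) /=.
rewrite exchange_big /=.
by rewrite big_bool addrC.
Qed.

Lemma charsum_frequency_diff (R : realType) (p d : nat) (nu i i' : 'F_p) :
  prime p -> (4 <= d)%N -> 2 != 0 :> 'F_p -> (forall x, x ^+ 2 != nu) ->
  charsum R (point d nu @: setT)
    (frequency d nu (i, false) - frequency d nu (i', true)) = 0.
Proof.
move=> p_pr d4 two0 nu_nsq; have nu0 : nu != 0.
  by have := nu_nsq 0; rewrite expr0n eq_sym.
rewrite charsum_point // /point /frequency /=.
pose f v := chi R (v - (i - i') ^+ 2).
(* the shifts of [j] that complete the squares on the two halves *)
rewrite (reindex_inj (addIr (i' - i))) /=.
rewrite [X in _ + X](reindex_inj (addIr (i' - i / nu))) /=.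
rewrite (eq_bigr (fun j => f (j ^+ 2))); last first.
  move=> j _; rewrite dotpDl dotpNl !dotp_vec4 // /f; congr chi.
  by ring.
rewrite [X in _ + X](eq_bigr (fun j => f (nu * j ^+ 2))); last first.
  move=> j _; rewrite dotpDl dotpNl !dotp_vec4 // /f; congr chi.
  by field.
rewrite sum_squares_nonsquares // /f.
under eq_bigr do rewrite -[X in X - _]mul1r.
by rewrite sum_chi_affine ?oner_eq0 // mul0rn.
Qed.

Lemma point_spectral (R : realType) (p d : nat) (nu : 'F_p) :
  prime p -> (4 <= d)%N -> 2 != 0 :> 'F_p -> (forall x, x ^+ 2 != nu) ->
  spectral R (point d nu @: setT).
Proof.
move=> p_pr d4 two0 nu_nsq; have nu0 : nu != 0.
  by have := nu_nsq 0; rewrite expr0n eq_sym.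
apply/spectral_charsumP => //; exists (frequency d nu @: setT); split.
  by rewrite !card_imset //; [apply: point_inj | apply: frequency_inj].
move=> _ _ /imsetP[[i s] _ ->] /imsetP[[i' s'] _ ->] ne.
have [ss'|] := eqVneq s s'; last first.
  case: s s' ne => [] [] // _ _; last exact: charsum_frequency_diff.
  by rewrite -opprB charsumN // charsum_frequency_diff // conjC0.
have ii' : i - i' != 0.
  by rewrite subr_eq0; apply: contraNneq ne => ->; rewrite ss'.
rewrite {s ne}ss' charsum_point // /point /frequency /=.
case: s'.
  rewrite (eq_bigr (fun j => chi R (2 * (i - i') * j + 0))); last first.
    by move=> j _; rewrite dotpDl dotpNl !dotp_vec4 //; congr chi; ring.
  rewrite sum_chi_affine ?mulf_neq0 // add0r.
  rewrite (eq_bigr (fun j => chi R (2 * nu * (i - i') * j +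
     (1 - nu) * (i ^+ 2 - i' ^+ 2)))).
    by rewrite sum_chi_affine ?mulf_neq0.
  by move=> j _; rewrite dotpDl dotpNl !dotp_vec4 //; congr chi; ring.
rewrite (eq_bigr (fun j => chi R (2 * (i - i') * j + 0))); last first.
  by move=> j _; rewrite dotpDl dotpNl !dotp_vec4 //; congr chi; ring.
rewrite sum_chi_affine ?mulf_neq0 // add0r.
rewrite (eq_bigr (fun j => chi R (2 * (i - i') * j +
   (nu^-1 - 1) * (i ^+ 2 - i' ^+ 2)))).
  by rewrite sum_chi_affine ?mulf_neq0.
by move=> j _; rewrite dotpDl dotpNl !dotp_vec4 //; congr chi; ring.
Qed.

Lemma spectral_not_tiling (R : realType) (p d : nat) :
  prime p -> odd p -> (4 <= d)%N ->
  exists E : {set Zpd p d}, [/\ spectral R E, #|E| = (2 * p)%N & ~ tiles E].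
Proof.
move=> p_pr p_odd d4.
have two0 : 2 != 0 :> 'F_p.
  rewrite -(dvdn_pcharf (pchar_Fp p_pr)) gtnNdvd //.
  by case: p p_pr p_odd => [|[|[|]]].
have [nu nu_nsq] := exists_nonsquare two0.
have cardE : #|point d nu @: setT| = (2 * p)%N.
  rewrite card_imset; last exact: point_inj.
  by rewrite cardsT card_prod card_bool card_Fp // mulnC.
exists (point d nu @: setT); split=> //; first exact: point_spectral.
move/(tiles_dvdn_card p_pr); rewrite cardE.
move/(dvdn_trans (dvdn_mulr p (dvdnn 2))).
by rewrite Euclid_dvdX // dvdn2 p_odd.
Qed.

Theorem theorem1p2 (R : realType) :
  [/\ (* (a) *)
      forall p : nat, prime p -> odd p ->
        exists E : {set Zpd p 5},
          [/\ spectral R E, #|E| = (2 * p)%N & ~ tiles E],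
      (* (b) *)
      forall p : nat, prime p -> p = 3 %[mod 4] ->
        exists E : {set Zpd p 4},
          [/\ spectral R E, #|E| = (2 * p)%N & ~ tiles E],
      forall p d : nat, prime p -> odd p -> (5 <= d)%N ->
        exists E : {set Zpd p d},
          [/\ E != set0, spectral R E & ~ tiles E],
      forall p d : nat, prime p -> (d <= 2)%N ->
        forall E : {set Zpd p d}, E != set0 -> spectral R E -> tiles E
    & forall p : nat, prime p -> p = 3 %[mod 4] ->
        exists E : {set Zpd p 4},
          [/\ E != set0, spectral R E & ~ tiles E]].
Proof.
have nonempty p d (E : {set Zpd p d}) :
    prime p -> #|E| = (2 * p)%N -> E != set0.
  by move=> p_pr cardE; rewrite -card_gt0 cardE muln_gt0 (prime_gt0 p_pr).
have odd_mod4 (p : nat) : p = 3 %[mod 4] -> odd p.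
  by move=> p3; rewrite -(@odd_mod p 4) // p3.
split.
- by move=> p p_pr p_odd; apply: spectral_not_tiling.
- by move=> p p_pr /odd_mod4 p_odd; apply: spectral_not_tiling.
- move=> p d p_pr p_odd d5.
  have [E [E_spec cardE E_ntile]] := spectral_not_tiling R p_pr p_odd (ltnW d5).
  by exists E; split=> //; apply: nonempty cardE.
- by move=> p d p_pr d2 E; apply: spectral_tiles_dim_le2.
move=> p p_pr /odd_mod4 p_odd.
have [E [E_spec cardE E_ntile]] := spectral_not_tiling R p_pr p_odd (leqnn 4).
by exists E; split=> //; apply: nonempty cardE.
Qed.
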